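(* For fixed $\rho_0,\rho_1\in\mathcal P^{\oplus}(\bar\Omega)$ the map $\kappa\mapsto\mathcal W_\kappa(\rho_0,\rho_1)$, $\kappa\in(0,+\infty)$, is nondecreasing.
   Context: Setting: $\Omega\subset\mathbb R^d$ is a smooth bounded domain; $\Gamma:=\partial\Omega$ is viewed as a smooth $(d-1)$-dimensional manifold without boundary, and $\nabla$ applied to functions on $\Gamma$ is the intrinsic (tangential) gradient. $Q_{\bar\Omega}:=[0,1]\times\bar\Omega$, $Q_\Gamma:=[0,1]\times\Gamma$. $\mathcal M(X)$, $\mathcal M^+(X)$, $\mathcal P(X)$ are the finite signed Borel measures, nonnegative measures, probability measures on $X$; $\mathcal M(Q_{\bar\Omega})^d$ and $\mathcal M(Q_\Gamma)^{d-1}$ denote vector measures (tangential to $\Gamma$ in the second case). Measures on $\Gamma$ are also regarded as measures on $\bar\Omega$ supported on $\partial\Omega$. $\mathcal P^{\oplus}(\bar\Omega):=\{(\omega,\gamma)\in\mathcal M^+(\bar\Omega)\times\mathcal M^+(\Gamma):\ \omega+\gamma\in\mathcal P(\bar\Omega)\}$. Continuity equations: for $\rho_i=(\omega_i,\gamma_i)\in\mathcal P^\oplus(\bar\Omega)$, $\mathcal{CE}(\rho_0,\rho_1)$ is the set of $\mu=(\omega,F;\gamma,G,f)\in\mathcal M(Q_{\bar\Omega})\times\mathcal M(Q_{\bar\Omega})^d\times\mathcal M(Q_\Gamma)\times\mathcal M(Q_\Gamma)^{d-1}\times\mathcal M(Q_\Gamma)$ such that, for all $\varphi\in\mathcal C^1(Q_{\bar\Omega})$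 and $\psi\in\mathcal C^1(Q_\Gamma)$, $$\iint_{Q_{\bar\Omega}}\partial_t\varphi\,d\omega+\iint_{Q_{\bar\Omega}}\nabla\varphi\cdot dF-\iint_{Q_\Gamma}\varphi\,df=\int_{\bar\Omega}\varphi(1,\cdot)\,d\omega_1-\int_{\bar\Omega}\varphi(0,\cdot)\,d\omega_0,$$ $$\iint_{Q_\Gamma}\partial_t\psi\,d\gamma+\iint_{Q_\Gamma}\nabla\psi\cdot dG+\iint_{Q_\Gamma}\psi\,df=\int_\Gamma\psi(1,\cdot)\,d\gamma_1-\int_\Gamma\psi(0,\cdot)\,d\gamma_0.$$ Action: $A_\Omega(\omega,F)=\frac{|F|^2}{2\omega}$ if $\omega>0$, $0$ if $(\omega,F)=(0,0)$, $+\infty$ otherwise, on $\mathbb R\times\mathbb R^d$; $A^\kappa_\Gamma(\gamma,G,f)=\frac{|G|^2+\kappa^2f^2}{2\gamma}$ if $\gamma>0$, $0$ if $(\gamma,G,f)=(0,0,0)$, $+\infty$ otherwise, on $\mathbb R\times\mathbb R^{d-1}\times\mathbb R$. For $\mu=(\mu_\Omega,\mu_\Gamma)$ with $\mu_\Omega=(\omega,F)$, $\mu_\Gamma=(\gamma,G,f)$, $$\mathcal A(\mu):=\iint_{Q_{\bar\Omega}}A_\Omega\Big(\tfrac{d\mu_\Omega}{d\lambda_\Omega}\Big)d\lambda_\Omega+\iint_{Q_\Gamma}A^\kappa_\Gamma\Big(\tfrac{d\mu_\Gamma}{d\lambda_\Gamma}\Big)d\lambda_\Gamma$$ for any nonnegative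 measures $\lambda_\Omega,\lambda_\Gamma$ with $|\mu_\Omega|\ll\lambda_\Omega$, $|\mu_\Gamma|\ll\lambda_\Gamma$ (independent of the choice by $1$-homogeneity). Finally $\mathcal W_\kappa^2(\rho_0,\rho_1):=\inf_{\mu\in\mathcal{CE}(\rho_0,\rho_1)}\mathcal A(\mu)$. *)

(* Defs.v *)
From HB Require Import structures.
From mathcomp Require Import all_boot all_order all_algebra.
From mathcomp Require Import all_classical all_reals all_analysis.

Set Implicit Arguments.
Unset Strict Implicit.
Unset Printing Implicit Defensive.
Import Order.TTheory GRing.Theory Num.Theory.
Import numFieldNormedType.Exports.
Local Open Scope classical_set_scope.
Local Open Scope ring_scope.

(* 'rV[R]_d carries the sup norm, which only serves to fix the topology; all
   metric quantities below are Euclidean. *)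
Definition dotv (R : realType) (d : nat) (u v : 'rV[R]_d) : R :=
  \sum_(i < d) u 0 i * v 0 i.

(* C^k on an open set U, by iterated directional derivatives; the values of f
   outside U are irrelevant. *)
Fixpoint Ck_on (R : realType) (V : normedModType R) (k : nat) (U : set V)
    (f : V -> R) : Prop :=
  if k is k'.+1 then
    (forall x, U x -> differentiable f x) /\
    (forall v, Ck_on k' U (fun x => 'D_v f x))
  else forall x, U x -> {for x, continuous f}.

Definition smooth_on (R : realType) (V : normedModType R) (U : set V)
    (f : V -> R) : Prop := forall k, Ck_on k U f.

Definition boundary (T : topologicalType) (A : set T) : set T :=
  closure A `\` interior A.

Definition smooth_boundary (R : realType) (d : nat) (Omega : set 'rV[R]_d) :=
  forall x, boundary Omega x ->
  exists (U : set 'rV[R]_d) (g : 'rV[R]_d -> R),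
    [/\ open U, U x, smooth_on U g,
        (forall y, U y -> exists v, 'D_v g y != 0) &
        Omega `&` U = [set y | g y < 0] `&` U].

Definition smooth_bounded_domain (R : realType) (d : nat)
    (Omega : set 'rV[R]_d) : Prop :=
  [/\ Omega !=set0, open Omega, connected Omega, bounded_set Omega &
      smooth_boundary Omega].

(* The tangent space at x of an embedded manifold S, as the set of velocities
   at x of the curves in S. *)
Definition tangent_space (R : realType) (d : nat) (S : set 'rV[R]_d)
    (x : 'rV[R]_d) : set 'rV[R]_d :=
  [set v | exists c : R -> 'rV[R]_d,
    [/\ c 0 = x, \forall t \near 0, S (c t) & is_derive (0 : R) 1 c v]].

Definition grad (R : realType) (d : nat) (f : 'rV[R]_d -> R)
    (x : 'rV[R]_d) : 'rV[R]_d := \row_i 'D_(delta_mx 0 i) f x.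

(* The Riemannian gradient on S of the restriction to S of f: the vector of
   the tangent space representing the differential of this restriction. *)
Definition tgrad (R : realType) (d : nat) (S : set 'rV[R]_d)
    (f : 'rV[R]_d -> R) (x : 'rV[R]_d) : 'rV[R]_d :=
  xget 0 [set w | tangent_space S x w /\
    forall v, tangent_space S x v -> dotv w v = 'D_v f x].

Notation Borel T := (g_sigma_algebraType (@open T)).

Section signed_measures.
Context (R : realType) (disp : measure_display) (T : measurableType disp).
Implicit Types (nu : {charge set T -> \bar R}) (D : set T).

(* A measure on a Borel subset D of T is encoded as a measure on T which
   vanishes outside D. *)
Definition concentrated (nu : set T -> \bar R) D : Prop :=
  forall A, measurable A -> A `&` D = set0 -> nu A = 0%E.

Definition hahn_pos nu : set T := sval (cid (Hahn_decomposition nu)).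

Definition hahn_neg nu : set T :=
  sval (cid (svalP (cid (Hahn_decomposition nu)))).

Definition hahnP nu : hahn_decomposition nu (hahn_pos nu) (hahn_neg nu) :=
  svalP (cid (svalP (cid (Hahn_decomposition nu)))).

Definition cintegral nu D (f : T -> R) : R :=
  \int[jordan_pos (hahnP nu)]_(x in D) f x -
  \int[jordan_neg (hahnP nu)]_(x in D) f x.

Definition vintegral (d : nat) (F : 'I_d -> {charge set T -> \bar R}) D
    (Phi : T -> 'rV[R]_d) : R :=
  \sum_(i < d) cintegral (F i) D (fun x => Phi x 0 i).

Definition total_variation (s : seq ({charge set T -> \bar R})) (A : set T) :
    \bar R := (\sum_(nu <- s) charge_variation (hahnP nu) A)%E.

Section total_variation_measure.
Variable s : seq ({charge set T -> \bar R}).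

Let tv0 : total_variation s set0 = 0%E.
Proof. by rewrite /total_variation big1 // => nu _; rewrite measure0. Qed.

Let tv_ge0 A : (0 <= total_variation s A)%E.
Proof. exact: sume_ge0. Qed.

Let tv_sigma_additive : semi_sigma_additive (total_variation s).
Proof.
rewrite /total_variation; elim: s => [|nu s' IH] F mF tF mUF.
  rewrite big_nil [X in X @ _ --> _](_ : _ = cst 0%E); first exact: cvg_cst.
  by apply/funext => n; rewrite big1 // => i _; rewrite big_nil.
rewrite big_cons [X in X @ _ --> _](_ : _ = (fun n =>
    \sum_(0 <= i < n) charge_variation (hahnP nu) (F i) +
    \sum_(0 <= i < n) \sum_(la <- s') charge_variation (hahnP la) (F i))%E).
  apply: cvgeD; last exact: IH.
  - by apply: ge0_adde_def; rewrite inE; [exact: measure_ge0|exact: sume_ge0].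
  - exact: measure_semi_sigma_additive.
by apply/funext => n; rewrite -big_split; apply: eq_bigr => i _; rewrite big_cons.
Qed.

HB.instance Definition _ := isMeasure.Build _ _ _ (total_variation s)
  tv0 tv_ge0 tv_sigma_additive.

Let tv_fin : fin_num_fun (total_variation s).
Proof.
move=> A mA; rewrite /total_variation sum_fin_num all_map.
by elim: s => //= nu s' ->; rewrite andbT fin_num_measure.
Qed.

HB.instance Definition _ := @Measure_isFinite.Build _ _ _
  (total_variation s) tv_fin.

End total_variation_measure.

Local Open Scope charge_scope.

Definition density nu (la : {finite_measure set T -> \bar R}) (x : T) : R :=
  fine ('d nu '/d la x).

Definition vdensity (d : nat) (F : 'I_d -> {charge set T -> \bar R})
    (la : {finite_measure set T -> \bar R}) (x : T) : 'rV[R]_d :=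
  \row_i density (F i) la x.

End signed_measures.

Section dynamic_transport.
Context (R : realType) (d : nat).
Implicit Types (Omega : set 'rV[R]_d).

Definition Qbar Omega : set (Borel (R * 'rV[R]_d)%type) :=
  `[0, 1]%classic `*` closure Omega.

Definition Qbdry Omega : set (Borel (R * 'rV[R]_d)%type) :=
  `[0, 1]%classic `*` boundary Omega.

Record state := State {
  st_omega : {finite_measure set (Borel 'rV[R]_d) -> \bar R} ;
  st_gamma : {finite_measure set (Borel 'rV[R]_d) -> \bar R} }.

Definition P_oplus Omega (rho : state) : Prop :=
  [/\ concentrated (st_omega rho) (closure Omega),
      concentrated (st_gamma rho) (boundary Omega) &
      (st_omega rho setT + st_gamma rho setT = 1)%E].

Record flow := Flow {
  fl_omega : {charge set (Borel (R * 'rV[R]_d)%type) -> \bar R} ;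
  fl_F : 'I_d -> {charge set (Borel (R * 'rV[R]_d)%type) -> \bar R} ;
  fl_gamma : {charge set (Borel (R * 'rV[R]_d)%type) -> \bar R} ;
  fl_G : 'I_d -> {charge set (Borel (R * 'rV[R]_d)%type) -> \bar R} ;
  fl_f : {charge set (Borel (R * 'rV[R]_d)%type) -> \bar R} }.

(* The (d-1)-dimensional vector measures of Gamma: R^d-valued measures whose
   polar density is tangent to Gamma. *)
Definition tangential Omega
    (G : 'I_d -> {charge set (Borel (R * 'rV[R]_d)%type) -> \bar R}) : Prop :=
  {ae total_variation (codom G), forall z, Qbdry Omega z ->
    tangent_space (boundary Omega) z.2
      (vdensity G (total_variation (codom G)) z)}.

Definition flow_on Omega (mu : flow) : Prop :=
  [/\ concentrated (fl_omega mu) (Qbar Omega),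
      forall i, concentrated (fl_F mu i) (Qbar Omega),
      concentrated (fl_gamma mu) (Qbdry Omega),
      (forall i, concentrated (fl_G mu i) (Qbdry Omega)) /\
        tangential Omega (fl_G mu) &
      concentrated (fl_f mu) (Qbdry Omega)].

Definition dt (phi : R * 'rV[R]_d -> R) (z : R * 'rV[R]_d) : R :=
  'D_(1, 0) phi z.

(* The test functions of class C^1 on the compact sets Qbar and Qbdry are the
   restrictions to these sets of the C^1 functions on the ambient space. *)
Definition CE Omega (rho0 rho1 : state) : set flow :=
  [set mu | flow_on Omega mu /\
   (forall phi : R * 'rV[R]_d -> R, Ck_on 1 setT phi ->
      cintegral (fl_omega mu) (Qbar Omega) (dt phi)
      + vintegral (fl_F mu) (Qbar Omega)
          (fun z => grad (fun x => phi (z.1, x)) z.2)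
      - cintegral (fl_f mu) (Qbdry Omega) phi
      = \int[st_omega rho1]_(x in closure Omega) phi (1, x)
      - \int[st_omega rho0]_(x in closure Omega) phi (0, x)) /\
   (forall psi : R * 'rV[R]_d -> R, Ck_on 1 setT psi ->
      cintegral (fl_gamma mu) (Qbdry Omega) (dt psi)
      + vintegral (fl_G mu) (Qbdry Omega)
          (fun z => tgrad (boundary Omega) (fun x => psi (z.1, x)) z.2)
      + cintegral (fl_f mu) (Qbdry Omega) psi
      = \int[st_gamma rho1]_(x in boundary Omega) psi (1, x)
      - \int[st_gamma rho0]_(x in boundary Omega) psi (0, x))].

Definition A_Omega (w : R) (F : 'rV[R]_d) : \bar R :=
  if 0 < w then (dotv F F / (2 * w))%:E
  else if (w == 0) && (F == 0) then 0%E else +oo%E.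

Definition A_Gamma (kappa w : R) (G : 'rV[R]_d) (f : R) : \bar R :=
  if 0 < w then ((dotv G G + kappa ^+ 2 * f ^+ 2) / (2 * w))%:E
  else if [&& w == 0, G == 0 & f == 0] then 0%E else +oo%E.

Definition action_wrt Omega (kappa : R)
    (laO laG : {finite_measure set (Borel (R * 'rV[R]_d)%type) -> \bar R})
    (mu : flow) : \bar R :=
  (\int[laO]_(z in Qbar Omega)
     A_Omega (density (fl_omega mu) laO z) (vdensity (fl_F mu) laO z) +
   \int[laG]_(z in Qbdry Omega)
     A_Gamma kappa (density (fl_gamma mu) laG z) (vdensity (fl_G mu) laG z)
       (density (fl_f mu) laG z))%E.

(* By 1-homogeneity of A_Omega and A_Gamma, [action_wrt] does not depend on the
   choice of dominating measures; the sums of the total variations of the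
   components are such measures. *)
Definition action Omega (kappa : R) (mu : flow) : \bar R :=
  action_wrt Omega kappa
    (total_variation (fl_omega mu :: codom (fl_F mu)))
    (total_variation (fl_gamma mu :: fl_f mu :: codom (fl_G mu))) mu.

Definition W Omega (rho0 rho1 : state) (kappa : R) : \bar R :=
  sqrte (ereal_inf [set action Omega kappa mu | mu in CE Omega rho0 rho1]).

End dynamic_transport.

(* Main.v *)
Require Import Defs.
From mathcomp Require Import all_boot all_order all_algebra.
From mathcomp Require Import all_classical all_reals all_analysis.
Local Open Scope ring_scope.
Import Order.TTheory GRing.Theory Num.Theory.

(** For a fixed flow the coupling constant [kappa] enters the action only
    through the numerator [|G|^2 + kappa^2 f^2] of the boundary density, which
    is nondecreasing in [kappa >= 0] ([A_Gamma_mono]); integrating, so is the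
    action of the flow ([action_mono]). The set [CE] of admissible flows does
    not depend on [kappa], so the infimum over it, and then the square root,
    preserve this monotonicity. *)

(** The integral of a nonnegative function is the supremum of the integrals of
    the simple functions below it, and a larger function has more of them. This
    holds for arbitrary functions, hence for the action densities as they
    stand. *)
Lemma ge0_le_integral_nomeas {disp : measure_display}
    {T : measurableType disp} {R : realType}
    (mu : {measure set T -> \bar R}) (D : set T) (f g : T -> \bar R) :
  (forall x, D x -> 0 <= f x)%E -> (forall x, D x -> f x <= g x)%E ->
  (\int[mu]_(x in D) f x <= \int[mu]_(x in D) g x)%E.
Proof.
move=> f0 fg; have g0 x : D x -> (0 <= g x)%E.
  by move=> Dx; exact: le_trans (f0 x Dx) (fg x Dx).
rewrite !ge0_integralE//; apply: ereal_sup_le => _ [h /= hf <-].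
exists h => //= x; apply: le_trans (hf x) _.
by rewrite /patch; case: ifPn => // /set_mem; exact: fg.
Qed.

Lemma dotv_ge0 {R : realType} {d : nat} (u : 'rV[R]_d) : 0 <= dotv u u.
Proof. by apply: sumr_ge0 => i _; rewrite -expr2 sqr_ge0. Qed.

Lemma A_Omega_ge0 {R : realType} {d : nat} (w : R) (F : 'rV[R]_d) :
  (0 <= A_Omega w F)%E.
Proof.
rewrite /A_Omega; case: ifP => [w0|_]; last by case: ifP.
by rewrite lee_fin divr_ge0 ?dotv_ge0// mulr_ge0// ltW.
Qed.

Lemma A_Gamma_ge0 {R : realType} {d : nat} (kappa w : R) (G : 'rV[R]_d)
    (f : R) : (0 <= A_Gamma kappa w G f)%E.
Proof.
rewrite /A_Gamma; case: ifP => [w0|_]; last by case: ifP.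
rewrite lee_fin divr_ge0// ?mulr_ge0//; last exact: ltW.
by rewrite addr_ge0 ?dotv_ge0// mulr_ge0// sqr_ge0.
Qed.

Lemma A_Gamma_mono {R : realType} {d : nat} (kappa1 kappa2 w : R)
    (G : 'rV[R]_d) (f : R) : 0 <= kappa1 -> kappa1 <= kappa2 ->
  (A_Gamma kappa1 w G f <= A_Gamma kappa2 w G f)%E.
Proof.
move=> k0 k12; rewrite /A_Gamma; case: ifP => // w0.
rewrite lee_fin ler_pM2r ?invr_gt0 ?mulr_gt0// lerD2l.
by rewrite ler_wpM2r ?sqr_ge0// lerXn2r// nnegrE (le_trans k0).
Qed.

Section Action.
Context {R : realType} {d : nat} (Omega : set 'rV[R]_d).

Lemma action_ge0 (kappa : R) (mu : flow R d) : (0 <= action Omega kappa mu)%E.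
Proof.
by apply: adde_ge0; apply: integral_ge0 => z _;
  [exact: A_Omega_ge0|exact: A_Gamma_ge0].
Qed.

Lemma action_mono (kappa1 kappa2 : R) (mu : flow R d) :
  0 <= kappa1 -> kappa1 <= kappa2 ->
  (action Omega kappa1 mu <= action Omega kappa2 mu)%E.
Proof.
move=> k0 k12; apply: leeD2l; apply: ge0_le_integral_nomeas => z _.
- exact: A_Gamma_ge0.
- exact: A_Gamma_mono.
Qed.

End Action.

Theorem proposition6p1 (R : realType) (d : nat) (d_gt0 : (0 < d)%N)
  (Omega : set 'rV[R]_d) (smooth_Omega : smooth_bounded_domain Omega)
  (rho0 rho1 : state R d)
  (rho0P : P_oplus Omega rho0) (rho1P : P_oplus Omega rho1)
  (kappa1 kappa2 : R) (kappa1_gt0 : 0 < kappa1)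
  (kappa12 : kappa1 <= kappa2) :
  (W Omega rho0 rho1 kappa1 <= W Omega rho0 rho1 kappa2)%E.
Proof.
rewrite /W lee_sqrt; last first.
  by apply: le_ereal_inf_tmp => _ [mu _ <-]; exact: action_ge0.
apply: le_ereal_inf_tmp => _ [mu mu_CE <-].
apply: ge_ereal_inf; exists (action Omega kappa1 mu); first by exists mu.
exact: action_mono (ltW kappa1_gt0) kappa12.
Qed.
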